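(* Let $G$ be a finite $\sigma$-$p$-group. For any $\sigma$-invariant normal subgroup $N\triangleleft G$ and any $\epsilon\in\{\pm1\}$ the projection $G\twoheadrightarrow G/N$ induces a surjective map $G^\epsilon\twoheadrightarrow(G/N)^\epsilon$ all of whose fibers have the same cardinality $|N^\epsilon|$. In particular $$|G^\epsilon|\ =\ |(G/N)^\epsilon|\cdot|N^\epsilon|.$$
   Context: Fix a prime $p>2$ and a group $\{1,\sigma\}$ of order $2$. A $\sigma$-$p$-group is a finite $p$-group $G$ with an action of $\{1,\sigma\}$ by automorphisms, written $a\mapsto{}^\sigma a$. For $\epsilon\in\{\pm1\}$ put $G^\epsilon:=\{a\in G\mid{}^\sigma a=a^\epsilon\}$. A $\sigma$-invariant normal subgroup $N$ and the quotient $G/N$ are $\sigma$-$p$-groups with the induced actions. *)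

(* Defs.v *)
From mathcomp Require Import all_boot all_order all_algebra all_fingroup all_solvable.

Set Implicit Arguments.
Unset Strict Implicit.
Unset Printing Implicit Defensive.

Local Open Scope group_scope.

Definition expgz (gT : finGroupType) (x : gT) (e : int) : gT :=
  match e with Posz n => x ^+ n | Negz n => x ^- n.+1 end.

(* X^e = { a in X | sigma a = a^e }, where sigma acts on X through [to]. *)
Definition eigen_set (aT : finGroupType) (D : {set aT}) (gT : finGroupType)
    (to : action D gT) (sigma : aT) (X : {set gT}) (e : int) : {set gT} :=
  [set a in X | to a sigma == expgz a e].

(* Main.v *)
(** Every element of a group of odd order is the square of one of its own powers.
    If [x] lifts an element of [(G/N)^e], the obstruction to [x] lying in [G^e] is
    some [n] in [N], and correcting [x] by a square root of [n] or [n^-1] removes it.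
    The fiber through [a = c ^+ 2] in [G^e], with [c] a power of [a], is [c N^e c],
    because [sigma c = c ^ e] makes [sigma (c m c) = (c m c) ^ e] equivalent to
    [sigma m = m ^ e], whatever the sign. *)

Require Import Defs.
From mathcomp Require Import all_boot all_order all_algebra all_fingroup all_solvable.

Set Implicit Arguments.
Unset Strict Implicit.
Unset Printing Implicit Defensive.

Local Open Scope group_scope.

(** Take [k = (#[x] + 1) / 2]. A root that is a power of [x] lies in every subgroup containing [x],
    and an automorphism that inverts or conjugates [x] does the same to it. *)
Lemma odd_order_sqrt (gT : finGroupType) (x : gT) :
  odd #[x] -> exists k, x ^+ k * x ^+ k = x.
Proof.
move=> ox; exists (#[x].+1)./2; rewrite -expgD addnn halfK /= ox subn0.
by rewrite expgS expg_order mulg1.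
Qed.

Section InvolutiveAction.

Variables (aT gT : finGroupType) (A : {group aT}) (G N : {group gT}).
Variables (to : groupAction A G) (s : aT) (e : int).
Hypotheses (As : s \in A) (ss : s * s = 1).
Hypotheses (nNG : N <| G) (sN : [acts A, on N | to]) (oddG : odd #|G|).
Hypothesis (he : e = 1%R \/ e = (-1)%R).

Lemma invol_actK x : to (to x s) s = x.
Proof. by rewrite -actMin // ss act1. Qed.

Lemma eigen_setP (X : {set gT}) x :
  reflect (x \in X /\ to x s = expgz x e) (x \in eigen_set to s X e).
Proof. by rewrite inE; apply: (iffP andP) => -[? /eqP]. Qed.

Lemma odd_sub_sqrt (H : {group gT}) x :
  H \subset G -> x \in H -> exists k, x ^+ k * x ^+ k = x.
Proof.
move=> sHG Hx; apply: odd_order_sqrt; apply: dvdn_odd oddG.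
exact/order_dvdG/(subsetP sHG).
Qed.

Lemma mem_eigen_quotient x :
  x \in G ->
  (coset N x \in eigen_set (to / N)%act s (G / N) e)
    = (coset N (to x s) == coset N (expgz x e)).
Proof.
move=> Gx; have Nx := subsetP (normal_norm nNG) x Gx.
(* The quotient action sends [coset N x] to [coset N (to x s)] only for [s] in [qact_dom to N]; the
   invariance of [N] ensures this. *)
have Ds : s \in qact_dom to N.
  by rewrite qact_domE ?normal_sub // (subsetP sN).
rewrite inE mem_quotient //= qactE //.
by case: he => ->; rewrite /= ?expg1 ?morphV.
Qed.

Lemma eigen_lift x :
  x \in G -> coset N (to x s) = coset N (expgz x e) ->
  exists2 y, y \in eigen_set to s G e & coset N y = coset N x.
Proof.
move=> Gx.
have NG := subsetP (normal_norm nNG); have subNG := subsetP (normal_sub nNG).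
have Gsx : to x s \in G by rewrite gact_stable.
(* It suffices to correct [x] on the right by some [m] in [N]. *)
have lift m : m \in N -> to (x * m) s = expgz (x * m) e ->
    exists2 y, y \in eigen_set to s G e & coset N y = coset N x.
  move=> Nm sE; exists (x * m); last exact: coset_kerr.
  by apply/eigen_setP; rewrite groupM ?(subNG m).
have inN y : y \in G -> coset N y = 1 -> y \in N.
  by move=> Gy; apply: coset_idr; apply: NG.
case: he lift => -> /= lift eqx.
  (* Case [e = 1]: as [s] is an involution, it inverts [n]. For [m = n ^+ k] with [m * m = n], the
     image of [x * m] is [x * n * m^-1 = x * m]. *)
  pose n := x^-1 * to x s.
  have Nn : n \in N.
    apply: inN; first by rewrite groupM ?groupV.
    by rewrite morphM ?morphV ?groupV ?NG //= eqx mulVg.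
  have Gn := subNG _ Nn.
  have sn : to n s = n^-1.
    by rewrite gactM ?groupV // gactV // invol_actK invMg invgK.
  have [k nk] := odd_sub_sqrt (normal_sub nNG) Nn.
  apply: (lift (n ^+ k)); first exact: groupX.
  rewrite gactM ?groupX // gactX // sn expgVn expg1.
  have -> : to x s = x * n by rewrite mulKVg.
  by rewrite -{1}nk !mulgA mulgK.
(* Case [e = -1]: now [s] sends [n] to [x * n * x^-1]. For [m = n ^- k], the image of [x * m] is
   [n * x^-1 * (x * m * x^-1) = n * m * x^-1], and [n * m = m^-1], so this is [(x * m)^-1]. *)
pose n := to x s * x.
have Nn : n \in N.
  apply: inN; first by rewrite groupM.
  by rewrite morphM ?NG //= eqx morphV ?NG //= mulVg.
have Gn := subNG _ Nn.
have sn : to n s = n ^ x^-1.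
  by rewrite gactM // invol_actK /n conjgE invgK mulgK.
have [k nk] := odd_sub_sqrt (normal_sub nNG) Nn.
apply: (lift (n ^- k)); first by rewrite groupV groupX.
rewrite gactM ?groupV ?groupX // gactV ?groupX // gactX // sn -conjXg -conjVg.
have -> : to x s = n * x^-1 by rewrite mulgK.
by rewrite conjgE !invgK invMg invgK -{1}nk !mulgA mulgKV mulgK.
Qed.

(** Inversion reverses products, so the translation of [m] to [a * m] need not respect the condition
    for [e = -1]; the palindromic [c * m * c] does. *)
Lemma card_eigen_fiber a :
  a \in eigen_set to s G e ->
  #|[set x in eigen_set to s G e | coset N x == coset N a]|
    = #|eigen_set to s N e|.
Proof.
case/eigen_setP=> Ga sa.
have NG := subsetP (normal_norm nNG); have subNG := subsetP (normal_sub nNG).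
have [k ak] := odd_sub_sqrt (subxx G) Ga; pose c := a ^+ k.
have Gc : c \in G by rewrite groupX.
have sc : to c s = expgz c e.
  by rewrite gactX // sa; case: he => -> /=; rewrite ?expg1 ?expgVn.
(* As [c] normalizes [N], this shows that [c * m * c] lies in the coset of [a] for [m] in [N]. *)
have cac m : c * m * c = a * m ^ c by rewrite -{1}ak conjgE !mulgA mulgK.
have stE m : m \in G ->
    (to (c * m * c) s == expgz (c * m * c) e) = (to m s == expgz m e).
  move=> Gm; rewrite !gactM ?groupM // sc; case: he => -> /=; rewrite ?expg1.
    by rewrite (inj_eq (mulIg _)) (inj_eq (mulgI _)).
  by rewrite !invMg mulgA (inj_eq (mulIg _)) (inj_eq (mulgI _)).
have injc : injective (fun m => c * m * c) by move=> x y /mulIg/mulgI.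
rewrite -[RHS](card_imset _ injc); congr #|pred_of_set _|; apply/setP=> x.
apply/setIdP/imsetP=> [[/eigen_setP[Gx sx] /eqP eqxa]|[m]]; last first.
  case/setIdP=> Nm sm ->; have Gm := subNG m Nm.
  rewrite inE stE // sm !groupM //= cac coset_kerr //.
  by rewrite memJ_norm ?NG.
(* The preimage of [x] comes from solving [a * m ^ c = x] for [m]. *)
have xE : x = c * (a^-1 * x) ^ c^-1 * c by rewrite cac conjgKV mulKVg.
have Nm : (a^-1 * x) ^ c^-1 \in N.
  rewrite memJ_norm ?groupV ?NG //; apply: coset_idr; first by rewrite groupM ?groupV ?NG.
  by rewrite morphM ?morphV ?groupV ?NG //= eqxa mulVg.
exists ((a^-1 * x) ^ c^-1) => //.
by rewrite inE Nm -stE ?subNG // -xE; apply/eqP.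
Qed.

Lemma eigen_quotient :
  coset N @: eigen_set to s G e = eigen_set (to / N)%act s (G / N) e.
Proof.
apply/setP=> b; apply/imsetP/idP=> [[x /eigen_setP[Gx sx] ->]|Eb].
  by rewrite mem_eigen_quotient // sx.
have /morphimP[x Nx Gx defb] : b \in G / N by case/setIdP: Eb.
move: Eb; rewrite defb mem_eigen_quotient // => /eqP/(eigen_lift Gx)[y Ey eqy].
by exists y.
Qed.

End InvolutiveAction.

Theorem proposition3p4 (p : nat) (p_pr : prime p) (p_gt2 : 2 < p)
    (aT : finGroupType) (A : {group aT}) (sigma : aT)
    (sigma_neq1 : sigma != 1) (defA : A :=: [set 1; sigma])
    (gT : finGroupType) (G : {group gT}) (pG : p.-group G)
    (to : groupAction A G)
    (N : {group gT}) (nNG : N <| G) (sN : [acts A, on N | to])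
    (e : int) (he : e = 1%R \/ e = (-1)%R) :
  [/\ coset N @: eigen_set to sigma G e
        = eigen_set (to / N)%act sigma (G / N) e,
      {in eigen_set (to / N)%act sigma (G / N) e, forall b : coset_of N,
        #|[set a in eigen_set to sigma G e | coset N a == b]|
          = #|eigen_set to sigma N e|}
    & #|eigen_set to sigma G e|
        = (#|eigen_set (to / N)%act sigma (G / N) e|
            * #|eigen_set to sigma N e|)%N].
Proof.
have As : sigma \in A by rewrite defA !inE eqxx orbT.
have ss : sigma * sigma = 1.
  (* The other possibility, [sigma * sigma = sigma], would force [sigma = 1]. *)
  have: sigma * sigma \in [set 1; sigma] by rewrite -defA groupM.
  case/set2P=> // /(canRL (mulgK _)); rewrite mulgV => /eqP.
  by rewrite (negPf sigma_neq1).
have oddG : odd #|G|.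
  have [p2|p_odd] := even_prime p_pr; first by rewrite p2 in p_gt2.
  by rewrite (card_pgroup pG) oddX p_odd orbT.
have im := eigen_quotient As ss nNG sN oddG he.
have fib : {in eigen_set (to / N)%act sigma (G / N) e, forall b : coset_of N,
    #|[set a in eigen_set to sigma G e | coset N a == b]|
      = #|eigen_set to sigma N e|}.
  move=> b; rewrite -im => /imsetP[a Ea ->].
  exact: (card_eigen_fiber As nNG oddG he).
(* The elements of [eigen_set to sigma G e] are counted coset by coset: [im] identifies the cosets
   that occur, and [fib] gives each the same contribution. *)
split=> //; rewrite -sum1_card (partition_big_imset (coset N)) /= im.
rewrite -sum_nat_const; apply: eq_bigr => b /fib <-.
by rewrite -sum1_card; apply: eq_bigl => x; rewrite !inE.
Qed.
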